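(* Let $A$ be a $2\times 2$ matrix with integer entries such that $\det A>0$ and $(\operatorname{Tr}A)^2<4\det A$. Let $R$ be the rotation matrix corresponding to $A$, that is, a rotation matrix for which $A=(\det A)^{1/2}\,QRQ^{-1}$ with $Q$ a real symmetric positive definite $2\times 2$ matrix. (i) If $(\operatorname{Tr}A)^2$ equals $0$, $\det A$, $2\det A$, or $3\det A$, let $\theta_0=\frac{\pi}{2},\frac{\pi}{3},\frac{\pi}{4},\frac{\pi}{6}$, respectively. Then the rotation angle of $R$ (modulo $2\pi$) is $\theta_0$ or $-\theta_0$ when $\operatorname{Tr}A\ge 0$, and is $\theta_0+\pi$ or $-\theta_0+\pi$ when $\operatorname{Tr}A<0$. (ii) If $(\operatorname{Tr}A)^2\notin\{0,\det A,2\det A,3\det A\}$, then the rotation angle of $R$ is incommensurable to $\pi$.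
   Context: A $2\times 2$ rotation matrix with angle $\theta$ is $R_\theta=\begin{pmatrix}\cos\theta & -\sin\theta\\ \sin\theta & \cos\theta\end{pmatrix}$; the angle is determined modulo $2\pi$. An angle $\theta$ is incommensurable to $\pi$ if $\theta/\pi$ is irrational. Under the hypotheses on $A$, the matrix $\frac{1}{(\det A)^{1/2}}A$ is diagonalizable over $\mathbb{C}$ with both eigenvalues of absolute value $1$ and has determinant $1$, and a decomposition $A=(\det A)^{1/2}QRQ^{-1}$ with $Q$ real symmetric positive definite and $R$ a rotation matrix exists. *)

(* Defs.v *)
From mathcomp Require Import all_boot all_order all_algebra.
From mathcomp Require Import boolp classical_sets reals trigo.

Set Implicit Arguments.
Unset Strict Implicit.
Unset Printing Implicit Defensive.

Import Order.TTheory GRing.Theory Num.Theory.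
Local Open Scope ring_scope.

Definition rotation_mx (R : realType) (theta : R) : 'M[R]_2 :=
  \matrix_(i < 2, j < 2)
    (if i == 0 then (if j == 0 then cos theta else - sin theta)
     else (if j == 0 then sin theta else cos theta)).

(* A rotation matrix has many angles, all congruent modulo 2 pi. *)
Definition is_rotation_angle (R : realType) (M : 'M[R]_2) (theta : R) : Prop :=
  M = rotation_mx theta.

Definition is_rotation (R : realType) (M : 'M[R]_2) : Prop :=
  exists theta : R, is_rotation_angle M theta.

Definition sym_posdef (R : realType) (n : nat) (Q : 'M[R]_n) : Prop :=
  Q \is symmetricmx /\
  forall v : 'cV[R]_n, v != 0 -> 0 < (v^T *m Q *m v) ord0 ord0.

Definition corresponding_rotation (R : realType) (A : 'M[int]_2)
    (M : 'M[R]_2) : Prop :=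
  is_rotation M /\
  exists Q : 'M[R]_2, sym_posdef Q /\
    map_mx intr A = Num.sqrt (\det A)%:~R *: (Q *m M *m invmx Q).

Definition eq_mod_2pi (R : realType) (x y : R) : Prop :=
  exists k : int, x = y + k%:~R * (2 * pi).

Definition incommensurable_pi (R : realType) (theta : R) : Prop :=
  irrational (theta / pi).

(* Main.v *)
Require Import Defs.
From mathcomp Require Import all_boot all_order all_algebra.
From mathcomp Require Import boolp classical_sets reals trigo.
From mathcomp Require Import ring lra.
Import Order.TTheory GRing.Theory Num.Theory.
Local Open Scope ring_scope.

Set Implicit Arguments.
Unset Strict Implicit.
Unset Printing Implicit Defensive.

(** Conjugation preserves the trace and a rotation has trace 2 cos theta, so
    Tr A = (det A)^(1/2) 2 cos theta: the hypotheses see theta only through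
    this one equation [trace_eq_cos]. It says that
    4 cos(theta)^2 = (Tr A)^2 / det A, and that cos theta has the sign of Tr A.

    When that quotient is 0, 1, 2 or 3, it is 4 cos(theta0)^2 for the
    corresponding special angle, so cos theta = cos theta0 or
    cos theta = - cos theta0 = cos (theta0 + pi) according to the sign of Tr A,
    and equal cosines mean equal angles up to sign and multiples of 2 pi
    [eq_cos_mod_2pi].

    For every other quotient, suppose that theta is a rational multiple of pi.
    Doubling the angle removes the square root:
    2 cos (2 theta) = (Tr A)^2 / det A - 2 is rational. By Niven's theorem
    [niven] the double cosine of a rational multiple of pi is an integer as soon
    as it is rational. So (Tr A)^2 / det A is an integer, and it lies in [0, 4)
    because (Tr A)^2 < 4 det A: it is one of 0, 1, 2, 3 after all.

    Niven's theorem itself rests on a congruence [int_scaled_cos]. If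
    2 cos phi = a / b in lowest terms, the integers u_n = b^n 2 cos (n phi)
    satisfy u_(n+2) = a u_(n+1) - b^2 u_n, hence u_n = a^n modulo b for n >= 1.
    If N phi is a multiple of 2 pi then u_N = 2 b^N, so that b divides a^N; as
    a and b are coprime, b = 1. *)

Lemma posdef_unitmx (R : realType) (n : nat) (Q : 'M[R]_n) :
  sym_posdef Q -> Q \in unitmx.
Proof.
move=> [_ Qpos]; rewrite unitmxE unitfE; apply/negP => /det0P[v v0 vQ].
have /Qpos : v^T != 0 by rewrite trmx_eq0.
by rewrite trmxK vQ mul0mx mxE ltxx.
Qed.

Lemma mxtrace_rotation (R : realType) (theta : R) :
  \tr (rotation_mx theta) = 2 * cos theta.
Proof. by rewrite /mxtrace big_ord_recr big_ord1 /= !mxE /=; ring. Qed.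

Lemma trace_eq_cos (R : realType) (A : 'M[int]_2) (Rot : 'M[R]_2) (theta : R) :
  corresponding_rotation A Rot -> is_rotation_angle Rot theta ->
  (\tr A)%:~R = Num.sqrt (\det A)%:~R * (2 * cos theta).
Proof.
move=> [_ [Q [/posdef_unitmx Qunit AQ]]] RotE; rewrite {Rot}RotE in AQ.
have -> : (\tr A)%:~R = \tr (map_mx intr A : 'M[R]_2).
  by rewrite /mxtrace rmorph_sum; apply: eq_bigr => i _; rewrite mxE.
by rewrite AQ mxtraceZ mxtrace_mulC mulmxA mulVmx// mul1mx mxtrace_rotation.
Qed.

Lemma sin_intmul_pi (R : realType) (k : int) : sin (k%:~R * pi : R) = 0.
Proof.
have sin_nat (n : nat) : sin (n%:R * pi : R) = 0.
  elim: n => [|n IHn]; first by rewrite mul0r sin0.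
  by rewrite -natr1 mulrDl mul1r sinDpi IHn oppr0.
case: k => n; first exact: sin_nat.
by rewrite NegzE mulrNz mulNr sinN sin_nat oppr0.
Qed.

(** Subtracting a multiple of pi moves x into [0, pi), where the sine is
    positive except at 0. *)
Lemma sin_eq0_pi (R : realType) (x : R) :
  sin x = 0 -> exists k : int, x = k%:~R * pi.
Proof.
move=> sinx0; exists (Num.floor (x / pi)); set k := Num.floor _.
have pi0 := pi_gt0 R.
have kle : k%:~R * pi <= x by rewrite -ler_pdivlMr// floor_le.
have ltk : x < k%:~R * pi + pi.
  rewrite -[X in _ + X]mul1r -mulrDl -ltr_pdivrMr//.
  by rewrite -[1]/(1%:~R) -intrD floorD1_gt.
have r0 : sin (x - k%:~R * pi) = 0.
  by rewrite sinB sinx0 sin_intmul_pi mul0r mulr0 subrr.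
apply/eqP; rewrite eq_le kle andbT leNgt; apply/negP => klt.
suff : 0 < sin (x - k%:~R * pi) by rewrite r0 ltxx.
by apply: sin_gt0_pi; rewrite subr_gt0 klt ltrBlDl.
Qed.

(** The difference cos x - cos y factors as
    - 2 sin ((x + y) / 2) sin ((x - y) / 2). *)
Lemma eq_cos_mod_2pi (R : realType) (x y : R) :
  cos x = cos y -> eq_mod_2pi x y \/ eq_mod_2pi x (- y).
Proof.
move=> cosxy; pose s := (x + y) / 2; pose d := (x - y) / 2.
have xE : x = s + d by rewrite /s /d; field.
have yE : y = s - d by rewrite /s /d; field.
have /eqP : sin s * sin d = 0.
  by move: cosxy; rewrite [in cos x]xE [in cos y]yE cosD cosB; lra.
rewrite mulf_eq0 => /orP[] /eqP/sin_eq0_pi[k kE]; [right|left]; exists k.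
  by rewrite xE yE kE; ring.
by rewrite xE yE kE; ring.
Qed.

(** The two right-hand sides differ by 2 pi: this restores the form of the angle
    in which pi is added after the change of sign. *)
Lemma eq_mod_2piN_Dpi (R : realType) (x y : R) :
  eq_mod_2pi x (- (y + pi)) -> eq_mod_2pi x (- y + pi).
Proof. by move=> [k ->]; exists (k - 1); rewrite intrB; ring. Qed.

(** With c = cos (pi / 3), the triple angle formula 4 c^3 - 3 c = cos pi = -1
    reads (c + 1) (2 c - 1)^2 = 0, and c is positive. *)
Lemma four_sqr_cos_pi3 (R : realType) : 4 * cos (pi / 3 : R) ^+ 2 = 1.
Proof.
set x := pi / 3; have pi0 := pi_gt0 R.
have c0 : 0 < cos x by apply: cos_gt0_pihalf; rewrite /x; lra.
have cos3 : cos (x *+ 2 + x) = -1.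
  by rewrite -cospi; congr cos; rewrite /x; field.
move: cos3; rewrite cosD cos_mulr2n sin_mulr2n => cos3.
have s2 := sin2cos2 x.
have : (cos x + 1) * (2 * cos x - 1) ^+ 2 = 0.
  transitivity (4 * cos x ^+ 3 - 3 * cos x + 1); first ring.
  have -> : 4 * cos x ^+ 3 - 3 * cos x + 1 =
    (cos x ^+ 2 *+ 2 - 1) * cos x - (cos x * (1 - cos x ^+ 2)) *+ 2 + 1 by ring.
  by rewrite -s2 -[RHS](addNr 1) -[in RHS]cos3; ring.
move/eqP; rewrite mulf_eq0 expf_eq0/= => /orP[/eqP|/eqP] h; first by lra.
have -> : cos x = 1 / 2 by lra.
by field.
Qed.

Lemma four_sqr_cos_pi4 (R : realType) : 4 * cos (pi / 4 : R) ^+ 2 = 2.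
Proof.
have : cos ((pi / 4 : R) *+ 2) = 0 by rewrite -cos_pihalf; congr cos; field.
by rewrite cos_mulr2n; lra.
Qed.

Lemma four_sqr_cos_pi6 (R : realType) : 4 * cos (pi / 6 : R) ^+ 2 = 3.
Proof.
have pi0 := pi_gt0 R.
have c0 : 0 < cos (pi / 3 : R) by apply: cos_gt0_pihalf; lra.
have : cos ((pi / 6 : R) *+ 2) = cos (pi / 3) by congr cos; field.
have := four_sqr_cos_pi3 R.
by rewrite cos_mulr2n; nra.
Qed.

(** The addition formula
    cos ((n + 2) phi) = 2 cos phi cos ((n + 1) phi) - cos (n phi), scaled
    by 2 b^(n + 2), becomes u_(n+2) = a u_(n+1) - b^2 u_n, whose last term vanishes
    modulo b. As u_0 = 2 need not be 1 modulo b, the index starts at 1. *)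
Lemma int_scaled_cos (R : realType) (phi : R) (a b : int) :
  b%:~R * (2 * cos phi) = a%:~R -> forall n : nat, exists2 u : int,
  (a ^+ n.+1 = u %[mod b])%Z &
  u%:~R = b%:~R ^+ n.+1 * (2 * cos (n.+1%:R * phi)).
Proof.
move=> abE n.
(* The recurrence has order two, so two consecutive terms are carried along. *)
suff [u [v [uE vE av]]] : exists u v : int,
    [/\ u%:~R = b%:~R ^+ n * (2 * cos (n%:R * phi)),
        v%:~R = b%:~R ^+ n.+1 * (2 * cos (n.+1%:R * phi)) &
        (a ^+ n.+1 = v %[mod b])%Z] by exists v.
elim: n => [|n [u [v [uE vE av]]]].
  exists 2, a; rewrite mul0r cos0 expr0 [1 * phi]mul1r; split=> //; ring.
exists v, (a * v - b ^+ 2 * u); split=> //.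
  rewrite intrB !intrM -abE vE uE.
  have -> : n.+2%:R * phi = n.+1%:R * phi + phi by rewrite -[n.+2%:R]natr1; ring.
  have -> : n%:R * phi = n.+1%:R * phi - phi by rewrite -[n.+1%:R]natr1; ring.
  by rewrite cosB cosD !exprS; ring.
rewrite exprS -modzMmr av modzMmr; apply/eqP; rewrite eqz_mod_dvd.
have -> : a * v - (a * v - b ^+ 2 * u) = (b * u) * b by ring.
exact: dvdz_mull.
Qed.

(** Niven's theorem; the hypothesis cos (N phi) = 1 with N > 0 encodes that phi
    is a rational multiple of pi. *)
Lemma niven (R : realType) (phi : R) (n : nat) (q : rat) :
  cos (n.+1%:R * phi) = 1 -> 2 * cos phi = ratr q -> q \is a Num.int.
Proof.
move=> cos1 cosq; set a := numq q; set b := denq q.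
have b0 : b%:~R != 0 :> R by rewrite intr_eq0 denq_neq0.
have [|u au] := @int_scaled_cos R phi a b _ n.
  by rewrite cosq /ratr mulrC mulfVK.
rewrite cos1 mulr1 -rmorphXn/= -[2]/(2%:~R) -intrM => /intr_inj uE.
have bdvd : (b %| a ^+ n.+1)%Z.
  by apply/dvdz_mod0P; rewrite au uE exprS -mulrA modzMr.
have bcoprime : coprimez b (a ^+ n.+1).
  by apply: coprimezXr; rewrite coprimez_sym; exact: coprime_num_den.
rewrite Qint_def -/b; have := bcoprime.
by rewrite /coprimez; move/gcdz_idPl: bdvd => ->; rewrite gtz0_abs ?denq_gt0.
Qed.

Lemma sqr_trace_cos (R : realType) (t d : int) (theta : R) :
  0 < d -> t%:~R = Num.sqrt d%:~R * (2 * cos theta) ->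
  t%:~R ^+ 2 = d%:~R * (4 * cos theta ^+ 2).
Proof.
move=> d0 ->; rewrite exprMn sqr_sqrtr ?ler0z ?ltW//; congr (_ * _); ring.
Qed.

(** The positive factor s stands for 2 (det A)^(1/2), so that s cos theta is the
    trace and its sign selects between the two cosines with the given square. *)
Lemma angle_of_sqr_cos (R : realType) (s theta theta0 : R) :
  0 < s -> 0 <= cos theta0 -> cos theta ^+ 2 = cos theta0 ^+ 2 ->
  (0 <= s * cos theta ->
     eq_mod_2pi theta theta0 \/ eq_mod_2pi theta (- theta0)) /\
  (s * cos theta < 0 ->
     eq_mod_2pi theta (theta0 + pi) \/ eq_mod_2pi theta (- theta0 + pi)).
Proof.
move=> s0 c0 /eqP; rewrite eqf_sqr => sqrE; split.
  rewrite pmulr_rge0// => c_ge0; apply: eq_cos_mod_2pi.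
  by case/orP: sqrE => /eqP; lra.
rewrite pmulr_rlt0// => c_lt0.
have /eq_cos_mod_2pi[] : cos theta = cos (theta0 + pi).
  by rewrite cosDpi; case/orP: sqrE => /eqP; lra.
- by left.
- by move/eq_mod_2piN_Dpi; right.
Qed.

Theorem theorem3p4 (R : realType) (A : 'M[int]_2)
    (det_gt0 : 0 < \det A) (tr_lt : (\tr A) ^+ 2 < 4 * \det A)
    (Rot : 'M[R]_2) (A_Rot : corresponding_rotation A Rot)
    (theta : R) (Rot_theta : is_rotation_angle Rot theta) :
  (forall theta0 : R,
     [\/ (\tr A) ^+ 2 = 0 /\ theta0 = pi / 2,
         (\tr A) ^+ 2 = \det A /\ theta0 = pi / 3,
         (\tr A) ^+ 2 = 2 * \det A /\ theta0 = pi / 4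
       | (\tr A) ^+ 2 = 3 * \det A /\ theta0 = pi / 6] ->
     (0 <= \tr A ->
        eq_mod_2pi theta theta0 \/ eq_mod_2pi theta (- theta0)) /\
     (\tr A < 0 ->
        eq_mod_2pi theta (theta0 + pi) \/ eq_mod_2pi theta (- theta0 + pi)))
  /\
  ((\tr A) ^+ 2 \notin [:: 0; \det A; 2 * \det A; 3 * \det A] ->
     incommensurable_pi theta).
Proof.
have trE := trace_eq_cos A_Rot Rot_theta.
have tr2E := sqr_trace_cos det_gt0 trE.
move: (\tr A) (\det A) det_gt0 tr_lt trE tr2E => t d d0 t2lt trE tr2E.
have dR0 : 0 < d%:~R :> R by rewrite ltr0z.
split=> [theta0 t2_cases|t2_notin].
  have [k t2k [theta0_ge0 cos_theta0]] : exists2 k : int, t ^+ 2 = k * d &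
      0 <= cos theta0 /\ 4 * cos theta0 ^+ 2 = k%:~R.
    have pi0 := pi_gt0 R.
    have cos_ge0 (n : R) : 2 <= n -> 0 <= cos (pi / n).
      move=> n2; apply: cos_ge0_pihalf.
      rewrite ler_pM2l// lef_pV2 ?posrE//; last lra.
      rewrite n2 andbT (@le_trans _ _ 0)//; first lra.
      by apply: divr_ge0; lra.
    case: t2_cases => -[-> ->].
    - exists 0; rewrite ?mul0r//; split; first by apply: cos_ge0; lra.
      by rewrite cos_pihalf expr0n mulr0.
    - exists 1; rewrite ?mul1r//; split; first by apply: cos_ge0; lra.
      exact: four_sqr_cos_pi3.
    - exists 2; split=> //; first by apply: cos_ge0; lra.
      exact: four_sqr_cos_pi4.
    - exists 3; split=> //; first by apply: cos_ge0; lra.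
      exact: four_sqr_cos_pi6.
  rewrite -(ler0z R) -(ltrz0 R) trE !mulrA.
  apply: angle_of_sqr_cos => //; first by rewrite mulr_gt0// sqrtr_gt0.
  move: tr2E; rewrite -rmorphXn/= t2k intrM -cos_theta0 [LHS]mulrC.
  by move=> /(mulfI (lt0r_neq0 dR0)); lra.
move=> [q _ qE].
(* The denominator of theta / pi turns 2 theta into a multiple of 2 pi. *)
have cos_multiple : cos ((`|denq q|.-1).+1%:R * (2 * theta)) = 1 :> R.
  have -> : (`|denq q|.-1).+1%:R * (2 * theta) = ((numq q)%:~R * pi) *+ 2 :> R.
    rewrite prednK ?absz_gt0// -[_%:R]/((Posz _)%:~R) gtz0_abs ?denq_gt0//.
    have -> : theta = ratr q * pi by rewrite qE mulfVK// lt0r_neq0// pi_gt0.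
    rewrite /ratr; field.
    by rewrite intr_eq0 denq_neq0.
  by rewrite cos_mulr2n cos2sin2 sin_intmul_pi; ring.
have cosq : 2 * cos (2 * theta) = ratr ((t ^+ 2)%:~R / d%:~R - 2).
  rewrite rmorphB /= fmorph_div/= !ratr_int rmorphXn/= tr2E [2 * theta]mulr_natl.
  rewrite cos_mulr2n ratr_nat; field.
  exact: lt0r_neq0.
have /intrP[m mE] := niven cos_multiple cosq.
have t2E : t ^+ 2 = (m + 2) * d.
  apply: (@intr_inj rat); rewrite [RHS]intrM intrD -mE subrK mulfVK//.
  by rewrite intr_eq0 lt0r_neq0.
have m_ge0 : 0 <= m + 2 by rewrite -(pmulr_lge0 _ d0) -t2E sqr_ge0.
have m_lt4 : m + 2 < 4 by rewrite -(ltr_pM2r d0) -t2E.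
move: t2_notin; rewrite t2E.
by case: (m + 2) m_ge0 m_lt4 => [[|[|[|[|//]]]]|//] _ _;
  rewrite !inE ?mul0r ?mul1r ?eqxx ?orbT.
Qed.
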